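(* There are no non-trivial repdigits which can be expressed as the difference of two balancing numbers. That is, there are no integers $n > m \geq 0$, $k \geq 2$ and $d \in \{1,2,\ldots,9\}$ such that $$B_n - B_m = d\left(\frac{10^k-1}{9}\right),$$ where $(B_n)_{n\geq 0}$ is the balancing number sequence.
   Context: The balancing number sequence $(B_n)_{n\geq 0}$ is the integer sequence defined by $B_0 = 0$, $B_1 = 1$ and $B_{n+1} = 6B_n - B_{n-1}$ for $n \geq 1$. A repdigit is a positive integer with only one distinct digit when written in base 10, i.e. a number of the form $d\left(\frac{10^k-1}{9}\right)$ with $d \in \{1,2,\ldots,9\}$ and $k \geq 1$. It is called trivial if $k = 1$, and non-trivial if $k \geq 2$. *)

(* Defs.v *)
From Stdlib Require Import ZArith.
Open Scope Z_scope.

Fixpoint balancing (n : nat) : Z :=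
  match n with
  | O => 0
  | S p =>
      match p with
      | O => 1
      | S q => 6 * balancing p - balancing q
      end
  end.

(* Main.v *)
(** The equation already fails modulo [1398100 = 4 * 25 * 11 * 31 * 41].
    Modulo this number the balancing numbers have period 60 and the repunits
    [11, 111, 1111, ...] have period 30, so only finitely many residues
    [B_n - B_m] and [d * R_k] have to be compared.  The factor 100 is what
    separates the non-trivial repdigits from the trivial ones: for [k >= 2]
    it forces [R_k] to be 11 modulo 100. *)
Require Import Defs.
From Stdlib Require Import ZArith List Lia.
Import ListNotations.
Open Scope Z_scope.

(** Applied with [h] a reduction modulo [modulus]: it turns an integer recurrence into an orbit on
    finitely many residues. *)
Lemma iter_semiconj (A B : Type) (h : A -> B) (g : A -> A) (f : B -> B) :
  (forall a, h (g a) = f (h a)) ->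
  forall n a, h (Nat.iter n g a) = Nat.iter n f (h a).
Proof.
  intros Hh n a; induction n as [|n IH]; simpl; [reflexivity|].
  now rewrite Hh, IH.
Qed.

Definition orbit {A : Type} (f : A -> A) (p : nat) (a : A) : list A :=
  map (fun i => Nat.iter i f a) (seq 0 p).

Lemma iter_mul_period (A : Type) (f : A -> A) (p : nat) (a : A) :
  Nat.iter p f a = a -> forall q, Nat.iter (q * p) f a = a.
Proof.
  intros Hp q; induction q as [|q IH]; [reflexivity|].
  now simpl; rewrite Nat.iter_add, IH.
Qed.

(** Divide [n] by [p]: the full periods fix [a], and the remainder is an index below [p]. *)
Lemma iter_in_orbit (A : Type) (f : A -> A) (p : nat) (a : A) :
  (0 < p)%nat -> Nat.iter p f a = a ->
  forall n, In (Nat.iter n f a) (orbit f p a).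
Proof.
  intros p_pos Hp n; apply in_map_iff; exists (n mod p)%nat; split.
  - transitivity (Nat.iter (n mod p + n / p * p) f a).
    + now rewrite Nat.iter_add, iter_mul_period.
    + f_equal; pose proof (Nat.div_mod_eq n p); lia.
  - apply in_seq; pose proof (Nat.mod_upper_bound n p); lia.
Qed.

Definition modulus : Z := 1398100.

(** Pairs of consecutive terms make the second-order recurrence the iteration of a single map. *)
Definition balancing_step (s : Z * Z) : Z * Z :=
  (snd s, 6 * snd s - fst s).

Definition balancing_step_mod (s : Z * Z) : Z * Z :=
  (snd s, (6 * snd s - fst s) mod modulus).

Definition balancing_residues : list Z :=
  map fst (orbit balancing_step_mod 60 (0, 1)).

Lemma iter_balancing_step (n : nat) :
  Nat.iter n balancing_step (0, 1) = (balancing n, balancing (S n)).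
Proof.
  induction n as [|n IH]; [reflexivity|].
  now change (Nat.iter (S n) balancing_step (0, 1))
    with (balancing_step (Nat.iter n balancing_step (0, 1))); rewrite IH.
Qed.

Lemma balancing_mod_in_residues (n : nat) :
  In (balancing n mod modulus) balancing_residues.
Proof.
  pose (h := fun s : Z * Z => (fst s mod modulus, snd s mod modulus)).
  assert (Hh : forall s, h (balancing_step s) = balancing_step_mod (h s)).
  { intros [x y]; unfold h, balancing_step, balancing_step_mod; simpl fst; simpl snd.
    f_equal.
    now rewrite Zminus_mod_idemp_r, <- (Zminus_mod_idemp_l (6 * (y mod modulus))),
      Zmult_mod_idemp_r, Zminus_mod_idemp_l. }
  apply in_map_iff; exists (h (Nat.iter n balancing_step (0, 1))); split.
  - now rewrite iter_balancing_step.
  - rewrite (iter_semiconj _ _ _ _ _ Hh).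
    apply iter_in_orbit; [lia | now vm_compute].
Qed.

Definition repunit (k : nat) : Z := Nat.iter k (fun r => 10 * r + 1) 0.

(** The start is [repunit 2]: modulo 100 the repunits run 0, 1, 11, 11, ..., so the orbit is purely
    periodic only from there. *)
Definition repunit_residues : list Z :=
  orbit (fun r => (10 * r + 1) mod modulus) 30 11.

Lemma repunit_eq (k : nat) : (10 ^ Z.of_nat k - 1) / 9 = repunit k.
Proof.
  assert (H : 10 ^ Z.of_nat k - 1 = repunit k * 9).
  { induction k as [|k IH]; [reflexivity|].
    rewrite Nat2Z.inj_succ, Z.pow_succ_r by lia.
    change (repunit (S k)) with (10 * repunit k + 1); lia. }
  now rewrite H, Z.div_mul.
Qed.

Lemma repunit_mod_in_residues (k : nat) :
  (2 <= k)%nat -> In (repunit k mod modulus) repunit_residues.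
Proof.
  intros Hk; replace k with (k - 2 + 2)%nat by lia.
  unfold repunit; rewrite Nat.iter_add.
  rewrite (iter_semiconj _ _ (fun r => r mod modulus) _
             (fun r => (10 * r + 1) mod modulus)).
  - apply iter_in_orbit; [lia | now vm_compute].
  - intros r; now rewrite <- (Zplus_mod_idemp_l (10 * (r mod modulus))),
      Zmult_mod_idemp_r, Zplus_mod_idemp_l.
Qed.

Definition repdigit_residues : list Z :=
  map (fun dr => (fst dr * snd dr) mod modulus)
    (list_prod [1; 2; 3; 4; 5; 6; 7; 8; 9] repunit_residues).

Lemma residues_disjoint (x y : Z) :
  In x balancing_residues -> In y balancing_residues ->
  ~ In ((x - y) mod modulus) repdigit_residues.
Proof.
  intros Hx Hy Hr.
  (* Exhaustive search: 60 * 60 pairs of balancing residues against the 9 * 30 products of a digit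
     and a repunit residue. *)
  assert (check :
    (let targets := repdigit_residues in
     forallb (fun xy => negb (existsb (Z.eqb ((fst xy - snd xy) mod modulus)) targets))
       (list_prod balancing_residues balancing_residues)) = true)
    by (vm_compute; reflexivity).
  cbv zeta in check; rewrite forallb_forall in check.
  specialize (check (x, y) (in_prod _ _ _ _ Hx Hy)).
  apply Bool.negb_true_iff in check; apply Bool.not_true_iff_false in check.
  apply check, existsb_exists; exists ((x - y) mod modulus).
  split; [exact Hr | apply Z.eqb_refl].
Qed.

Theorem theorem3p1 :
  ~ exists (n m k : nat) (d : Z),
      (n > m)%nat /\ (k >= 2)%nat /\ 1 <= d <= 9 /\
      balancing n - balancing m = d * ((10 ^ Z.of_nat k - 1) / 9).
Proof.
  intros (n & m & k & d & _ & Hk & Hd & E).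
  rewrite repunit_eq in E.
  apply (residues_disjoint _ _ (balancing_mod_in_residues n) (balancing_mod_in_residues m)).
  (* The difference of the two residues is congruent to the repdigit, which must then be found among
     the excluded residues. *)
  rewrite <- Zminus_mod, E.
  apply in_map_iff; exists (d, repunit k mod modulus); split.
  - apply Zmult_mod_idemp_r.
  - apply in_prod; [simpl; lia | now apply repunit_mod_in_residues].
Qed.
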